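(* There is an absolute constant $C>0$ such that the following holds. Let $\gamma>0$ and let $M$ be an $n\times n$ Boolean matrix with $\gamma_2(M)\leq\gamma$ and $p(M)\leq 1/2$. Then $M$ contains a $t\times t$ all-zeros submatrix for some $t\geq n2^{-C\gamma^3}$ (i.e. $t=n2^{-O(\gamma^3)}$).
   Context: A Boolean matrix has entries in $\{0,1\}$; a submatrix is obtained by selecting any subset of rows and columns. For an $m\times n$ Boolean matrix $M$, $p(M)=|M|/(mn)$ is the density of one-entries, where $|M|$ is the number of one-entries. For a real matrix $M$, $\gamma_2(M)=\min_{U,V:\,M=UV}\|U\|_{\mathrm{row}}\|V\|_{\mathrm{col}}$, where $\|U\|_{\mathrm{row}}$ is the maximum Euclidean norm of a row of $U$ and $\|V\|_{\mathrm{col}}$ is the maximum Euclidean norm of a column of $V$. *)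

(* Defs.v *)
From HB Require Import structures.
From mathcomp Require Import all_boot all_order all_algebra.
From mathcomp Require Import all_classical all_reals all_analysis.

Set Implicit Arguments.
Unset Strict Implicit.
Unset Printing Implicit Defensive.

Import Order.TTheory GRing.Theory Num.Theory.

Local Open Scope classical_set_scope.
Local Open Scope ring_scope.

Section BooleanMatrices.
Variables (R : realType) (m n : nat).
Implicit Type M : 'M[bool]_(m, n).

Definition real_mx M : 'M[R]_(m, n) := map_mx (fun b : bool => b%:R) M.

Definition num_ones M : nat := #|[set ij : 'I_m * 'I_n | M ij.1 ij.2]%SET|.

(* If m = 0 or n = 0, this is 0 since x / 0 = 0. *)
Definition density M : R := (num_ones M)%:R / (m * n)%:R.

Definition zero_submx M (t s : nat) : Prop :=
  exists (A : {set 'I_m}) (B : {set 'I_n}),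
    [/\ #|A| = t, #|B| = s &
        forall i j, i \in A -> j \in B -> M i j = false].

End BooleanMatrices.

Section Gamma2.
Variable R : realType.

Definition row_norm (m k : nat) (U : 'M[R]_(m, k)) : R :=
  \big[Num.max/0]_(i < m) Num.sqrt (\sum_(j < k) U i j ^+ 2).

Definition col_norm (k n : nat) (V : 'M[R]_(k, n)) : R :=
  \big[Num.max/0]_(j < n) Num.sqrt (\sum_(i < k) V i j ^+ 2).

Definition factorization_costs (m n : nat) (M : 'M[R]_(m, n)) : set R :=
  [set c | exists (k : nat) (U : 'M[R]_(m, k)) (V : 'M[R]_(k, n)),
      M = U *m V /\ c = row_norm U * col_norm V].

(* The infimum is a minimum: projecting onto the span of the rows of U reduces
   to k <= m, and balancing the two norms leaves a compact set of pairs. *)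
Definition gamma2 (m n : nat) (M : 'M[R]_(m, n)) : R :=
  inf (factorization_costs M).

(* [inf] is 0 by convention on sets without an infimum; this case is void. *)
Lemma factorization_costs_has_inf (m n : nat) (M : 'M[R]_(m, n)) :
  has_inf (factorization_costs M).
Proof.
split; first by exists (row_norm M * col_norm (1%:M : 'M[R]_n)), n, M, 1%:M; rewrite mulmx1.
exists 0 => _ [k [U [V [_ ->]]]]; rewrite mulr_ge0 // /row_norm /col_norm;
  by elim/big_ind: _ => // x y x0 y0; rewrite le_max x0.
Qed.

End Gamma2.

(* Main.v *)
(* By Grothendieck's inequality, a submatrix of density [p <= 1/2] contains a
   rectangle of area [sigma] times its own and density at most
   [p (1 - c / (gamma sigma))]. Iterating, one reaches density [2^(-O(gamma^2))]
   at a cost of [2^(-O(gamma^3))] in size.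

   In the sparse regime write [M i j = <u i, v j>] with all vectors of squared
   norm at most [G = O(gamma)]. The rows [S] with a one in column [a] satisfy
   [<u i, v a> = 1], so a perceptron finds a sum [w] of [O(G^2)] of these [u i]
   having a large product with all of them. Projecting the [u i] off [w] lowers
   their squared norms by [1/(16 G)] and only changes the products with columns
   meeting the summed rows. Cutting out cells [S] greedily by largest relative
   degree keeps the number of such columns proportional to the number of rows
   covered, so a fraction [1/(32 G^2)] of the rows (or columns) can be treated at
   once while half of the columns (or rows) survive. The squared norms bound the
   number of such rounds by [32 G^2], and each one multiplies the density by at
   most [8]; hence a zero rectangle appears before the density gets large. *)

Require Import Defs.
From HB Require Import structures.
From mathcomp Require Import all_boot all_order all_algebra.
From mathcomp Require Import reals ring lra zify.

Set Implicit Arguments.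
Unset Strict Implicit.
Unset Printing Implicit Defensive.

Import Order.TTheory GRing.Theory Num.Theory.

Local Open Scope ring_scope.

(** * A weak form of Grothendieck's inequality *)

(** Any finite type may index the coordinates, so that functions on a space of sign patterns are
    again vectors. *)
Definition dot (R : realType) (T : finType) (x y : T -> R) : R := \sum_t x t * y t.

Section Grothendieck.
Variable R : realType.

Fixpoint signs (n : nat) : finType :=
  if n is n'.+1 then (bool * signs n')%type else unit.

(** The Rademacher sum of [f] over [s], a random variable on the uniform space of sign patterns. *)
Fixpoint rad (T : Type) (f : T -> R) (s : seq T) : signs (size s) -> R :=
  match s with
  | [::] => fun=> 0
  | t :: s' => fun e => (-1) ^+ (e.1 : bool) * f t + rad f (s := s') e.2
  end.

Lemma sum_signsS n (F : signs n.+1 -> R) :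
  \sum_e F e = \sum_e (F (true, e) + F (false, e)).
Proof.
rewrite big_split /= -(big_bool _ (fun b => \sum_e F (b, e))) pair_bigA.
by apply: eq_bigr => -[].
Qed.

Lemma card_signs n : \sum_(e : signs n) 1 = 2 ^+ n :> R.
Proof.
elim: n => [|n IH]; first by rewrite big_const /= card_unit /= addr0 expr0.
by rewrite sum_signsS big_split /= IH exprS; ring.
Qed.

Lemma rad_cons (T : Type) (f : T -> R) t s b (e : signs (size s)) :
  rad f (s := t :: s) (b, e) = (-1) ^+ b * f t + rad f (s := s) e.
Proof. by []. Qed.

Lemma rad_cov (T : Type) (f g : T -> R) (s : seq T) :
  \sum_e rad f (s := s) e * rad g e = 2 ^+ size s * \sum_(t <- s) f t * g t.
Proof.
elim: s => [|t s IH].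
  by rewrite big_nil mulr0 big1 // => e _; rewrite mul0r.
transitivity (\sum_(e : signs (size s))
    (2 * (f t * g t) * 1 + 2 * (rad f (s := s) e * rad g (s := s) e))).
  rewrite [LHS]sum_signsS; apply: eq_bigr => e _.
  by rewrite !rad_cons !(expr0, expr1); ring.
rewrite big_split -!mulr_sumr IH card_signs big_cons.
by rewrite [size (t :: s)]/= (exprS _ (size s)) /=; ring.
Qed.

(** Khintchine's inequality for the fourth moment. Averaging over the sign of [a = f t] leaves
    [a^4 + 6 a^2 X^2 + X^4], and the middle term matches the cross term of [3 (a^2 + S)^2]. *)
Lemma rad_moment4 (T : Type) (f : T -> R) (s : seq T) :
  \sum_e rad f (s := s) e ^+ 4
    <= 2 ^+ size s * (3 * (\sum_(t <- s) f t * f t) ^+ 2).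
Proof.
elim: s => [|t s IH].
  rewrite big_nil expr0n /= !mulr0 big1 // => e _; exact: expr0n.
have -> : \sum_e rad f (s := t :: s) e ^+ 4 = \sum_(e : signs (size s))
    (2 * f t ^+ 4 * 1 + 12 * f t ^+ 2 * (rad f (s := s) e * rad f (s := s) e)
      + 2 * rad f (s := s) e ^+ 4).
  rewrite [LHS]sum_signsS; apply: eq_bigr => e _.
  by rewrite !rad_cons !(expr0, expr1); ring.
rewrite !big_split -!mulr_sumr rad_cov card_signs big_cons.
rewrite [size (t :: s)]/= (exprS _ (size s)).
set S := \sum_(t <- s) f t * f t in IH *; set q := 2 ^+ size s in IH *.
have q0 : 0 <= q by rewrite exprn_ge0.
have h : 0 <= q * f t ^+ 4 by rewrite mulr_ge0 // (exprM _ 2 2) sqr_ge0.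
have -> : 2 * q * (3 * (f t * f t + S) ^+ 2) = 6 * (q * f t ^+ 4) +
  12 * f t ^+ 2 * (q * S) + 2 * (q * (3 * S ^+ 2)) by ring.
have -> : 2 * f t ^+ 4 * q = 2 * (q * f t ^+ 4) by ring.
rewrite /=; lra.
Qed.

Definition clip (x : R) : R := Num.max (- 2) (Num.min 2 x).

Lemma clipP (x : R) :
  [\/ 2 <= x /\ clip x = 2, x <= -2 /\ clip x = -2 | -2 <= x <= 2 /\ clip x = x].
Proof.
rewrite /clip; case: (leP 2 x) => x2.
  by apply: Or31; split=> //; apply/max_idPr; lra.
case: (leP x (-2)) => x3; [apply: Or32|apply: Or33]; split=> //.
by apply/andP; split; lra.
Qed.

Lemma clip_bounds (x : R) : -1 <= clip x / 2 <= 1.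
Proof. by have [[? ->]|[? ->]|[/andP[? ?] ->]] := clipP x; apply/andP; split; lra. Qed.

Lemma clip_sqr (x : R) : clip x * clip x <= x * x.
Proof. by have [[? ->]|[? ->]|[? ->]] := clipP x; nra. Qed.

(* From [|x| - 2 <= x^2 / 8], i.e. [(|x| - 4)^2 >= 0]. *)
Lemma clip_tail (x : R) : (4 * (x - clip x)) * (4 * (x - clip x)) <= x ^+ 4 / 4.
Proof.
have h (z : R) : 0 <= z -> z <= x ^+ 2 / 8 -> 4 * z * (4 * z) <= x ^+ 4 / 4.
  move=> z0 zx; have : z ^+ 2 <= (x ^+ 2 / 8) ^+ 2.
    by rewrite lerXn2r // nnegrE; lra.
  rewrite (_ : (x ^+ 2 / 8) ^+ 2 = x ^+ 4 / 64); last by field.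
  by move=> ?; nra.
have [[? ->]|[? ->]|[? ->]] := clipP x.
- by apply: h; [lra|have := sqr_ge0 (x - 4); nra].
- rewrite -[leLHS]mulrNN -!mulrN opprB; apply: h; first lra.
  by have := sqr_ge0 (x + 4); nra.
- by rewrite subrr !mulr0 divr_ge0 // (exprM _ 2 2) sqr_ge0.
Qed.

Variables (I J : finType) (N : I -> J -> R).

(** The weight [w] allows inner products of normalised measures without square roots. The type [T]
    is quantified inside because the halving step passes from [T] to sign patterns. *)
Definition vector_bound (G : R) : Prop :=
  forall (T : finType) (w : R) (x : I -> T -> R) (y : J -> T -> R), 0 <= w ->
    (forall i, w * dot (x i) (x i) <= 1) -> (forall j, w * dot (y j) (y j) <= 1) ->
    \sum_i \sum_j N i j * (w * dot (x i) (y j)) <= G.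

(** Starting point of the halving: expanding the squared norms of [x i + y j] and [x i - y j] bounds
    each weighted product by 1 in absolute value. *)
Lemma vector_bound_abs : vector_bound (\sum_i \sum_j `|N i j|).
Proof.
move=> T w x y w0 x1 y1; apply: ler_sum => i _; apply: ler_sum => j _.
apply: le_trans (ler_norm _) _; rewrite normrM ler_piMr //.
have h (s : R) : s ^+ 2 = 1 ->
    0 <= dot (x i) (x i) + dot (y j) (y j) + 2 * s * dot (x i) (y j).
  move=> s1; have -> : dot (x i) (x i) + dot (y j) (y j) + 2 * s * dot (x i) (y j)
    = \sum_t (x i t + s * y j t) ^+ 2.
    rewrite /dot mulr_sumr -!big_split /=; apply: eq_bigr => t _.
    by rewrite sqrrD exprMn s1; ring.
  by apply: sumr_ge0 => t _; rewrite sqr_ge0.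
have h1 := mulr_ge0 w0 (h 1 (expr1n _ _)).
have h2 := mulr_ge0 w0 (h (-1) (etrans (sqrrN 1) (expr1n _ 2))).
by move: (x1 i) (y1 j) => *; rewrite ler_norml; apply/andP; split; lra.
Qed.

(* Replacing vectors by Rademacher sums and clipping these at 2 splits the form
   into a part bounded by [4 L] and two parts with one factor in the ball of
   radius 1/4, by the fourth moment; these are bounded by [(8 L + d) / 4]. *)
Lemma vector_bound_half (L d : R) :
  (forall (x : I -> R) (y : J -> R),
     (forall i, -1 <= x i <= 1) -> (forall j, -1 <= y j <= 1) ->
     \sum_i \sum_j N i j * (x i * y j) <= L) ->
  vector_bound (8 * L + d) -> vector_bound (8 * L + d / 2).
Proof.
move=> HL HG T w x y w0 x1 y1.
set s := enum T; set p : R := (2 ^+ size s)^-1.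
have p0 : 0 <= p by rewrite invr_ge0 exprn_ge0.
have pK : p * 2 ^+ size s = 1 by rewrite /p mulVf // expf_neq0 // pnatr_eq0.
pose Z (f : T -> R) := rad (fun t => Num.sqrt w * f t) (s := s).
pose X i := Z (x i); pose Y j := Z (y j).
have cov (f g : T -> R) : w * dot f g = p * dot (Z f) (Z g).
  rewrite {2}/dot rad_cov mulrA pK mul1r big_enum /= /dot mulr_sumr.
  apply: eq_bigr => t _; rewrite -{1}[w]sqr_sqrtr //; ring.
(* The factor 4 is what the fourth moment allows: for [f] in the unit ball, [clip_tail] and
   [rad_moment4] bound the squared norm of [tl f] by 3/4. *)
pose tl f e := 4 * (Z f e - clip (Z f e)).
have tail (f : T -> R) : w * dot f f <= 1 -> p * dot (tl f) (tl f) <= 1.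
  move=> f1; have m4 := rad_moment4 (fun t => Num.sqrt w * f t) s.
  have : p * dot (tl f) (tl f) <= p * ((\sum_e Z f e ^+ 4) / 4).
    by rewrite ler_wpM2l // mulr_suml; apply: ler_sum => e _; exact: clip_tail.
  move/le_trans; apply; move: m4; rewrite -/(Z f).
  have <- : w * dot f f = \sum_(t <- s) Num.sqrt w * f t * (Num.sqrt w * f t).
    rewrite /dot mulr_sumr big_enum; apply: eq_bigr => t _.
    by rewrite -{1}[w]sqr_sqrtr //; ring.
  move=> /(ler_wpM2l p0); rewrite (mulrA p (2 ^+ _)) pK mul1r.
  have : (w * dot f f) ^+ 2 <= 1.
    by rewrite expr_le1 // mulr_ge0 //; apply: sumr_ge0 => t _; rewrite -expr2 sqr_ge0.
  by move=> *; rewrite mulrA; lra.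
have clp (f : T -> R) : w * dot f f <= 1 ->
  p * dot (clip \o Z f) (clip \o Z f) <= 1.
  move=> f1; apply: le_trans f1; rewrite cov ler_wpM2l //.
  by apply: ler_sum => e _; exact: clip_sqr.
(* [X Y = clip X clip Y + (X - clip X) Y + clip X (Y - clip Y)]. *)
have split i j : N i j * (w * dot (x i) (y j)) =
    p * (\sum_e 4 * (N i j * (clip (X i e) / 2 * (clip (Y j e) / 2))))
  + N i j * (p * dot (tl (x i)) (Y j)) / 4
  + N i j * (p * dot (clip \o X i) (tl (y j))) / 4.
  rewrite cov -/(X i) -/(Y j) /dot !(mulr_sumr, mulr_suml) -!big_split /=.
  by apply: eq_bigr => e _; rewrite /tl -/(X i) -/(Y j); field.
under eq_bigr => i _ do under eq_bigr => j _ do rewrite split.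
under eq_bigr => i _ do rewrite !big_split /= -!mulr_suml -mulr_sumr.
rewrite !big_split /= -!mulr_suml -mulr_sumr.
have y1' j : p * dot (Y j) (Y j) <= 1 by rewrite -cov.
have b1 := HG _ p (fun i => tl (x i)) Y p0 (fun i => tail _ (x1 i)) y1'.
have b2 := HG _ p (fun i => clip \o X i) (fun j => tl (y j)) p0
  (fun i => clp _ (x1 i)) (fun j => tail _ (y1 j)).
have b3 : p * (\sum_i \sum_j \sum_e 4 * (N i j * (clip (X i e) / 2 * (clip (Y j e) / 2))))
   <= 4 * L.
  have -> : 4 * L = p * (\sum_(e : signs (size s)) 4 * L).
    by rewrite -[in RHS](mul1r (4 * L)) -mulr_suml card_signs mulrA pK mul1r.
  rewrite ler_wpM2l //.
  under eq_bigr => i _ do rewrite exchange_big /=.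
  rewrite exchange_big /=; apply: ler_sum => e _.
  under eq_bigr => i _ do rewrite -mulr_sumr.
  rewrite -mulr_sumr ler_wpM2l //.
  by apply: (HL (fun i => clip (X i e) / 2) (fun j => clip (Y j e) / 2)) => ?;
    exact: clip_bounds.
lra.
Qed.

(** Repeated halving, starting from the sum of absolute values, pushes the excess over [8 L] below
    any positive number. *)
Lemma grothendieck (L : R) :
  (forall (x : I -> R) (y : J -> R),
     (forall i, -1 <= x i <= 1) -> (forall j, -1 <= y j <= 1) ->
     \sum_i \sum_j N i j * (x i * y j) <= L) ->
  vector_bound (8 * L).
Proof.
move=> HL T w x y w0 x1 y1.
set D := \sum_i \sum_j `|N i j|.
have step t : vector_bound (8 * L + (D - 8 * L) / 2 ^+ t).
  elim: t => [|t IH]; first by rewrite expr0 divr1 addrC subrK; exact: vector_bound_abs.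
  by rewrite exprSr invfM mulrA; exact: vector_bound_half.
set v := (X in X <= _).
rewrite leNgt; apply/negP => lt.
pose q := (D - 8 * L) / (v - 8 * L).
have [t ht] : exists t, q < 2 ^+ t.
  by exists (Num.bound q); apply: upper_nthrootP.
have := step t T w x y w0 x1 y1; rewrite -/v.
have p0 : 0 < 2 ^+ t :> R by rewrite exprn_gt0.
move: ht; rewrite /q ltr_pdivrMr ?subr_gt0 // => ht.
by rewrite leNgt -ltrBrDl ltr_pdivrMr // (mulrC (v - _)) ht.
Qed.

End Grothendieck.

(** * Reaching small density *)

Lemma bernoulli_ineq (R : realDomainType) (x : R) n :
  0 <= x -> 1 + n%:R * x <= (1 + x) ^+ n.
Proof.
move=> x0; elim: n => [|n IH]; first by rewrite mul0r addr0 expr0.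
rewrite exprS -natr1; have n0 : 0 <= n%:R * x * x by rewrite !mulr_ge0.
apply: le_trans (_ : (1 + x) * (1 + n%:R * x) <= _); first lra.
by rewrite ler_wpM2l //; lra.
Qed.

Definition rect_sum (R : nmodType) (I J : finType) (N : I -> J -> R)
    (A : {set I}) (B : {set J}) : R :=
  \sum_(i in A) \sum_(j in B) N i j.

Lemma sum_neg_le (R : realType) (I : finType) (f x : I -> R) :
  (forall i, 0 <= x i <= 1) ->
  \sum_(i in [set i | f i < 0]) f i <= \sum_i x i * f i.
Proof.
move=> x01; rewrite big_mkcond; apply: ler_sum => i _; rewrite inE.
by case: ltP => fi; have /andP[? ?] := x01 i; nra.
Qed.

(** A bilinear form on a box is least at a vertex: first [x], then [y] is replaced by the indicator
    of its negative coefficients. *)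
Lemma rect_sum_min (R : realType) (I J : finType) (N : I -> J -> R) (l : R)
    (x : I -> R) (y : J -> R) :
  (forall A B, - l <= rect_sum N A B) ->
  (forall i, 0 <= x i <= 1) -> (forall j, 0 <= y j <= 1) ->
  - l <= \sum_i \sum_j N i j * (x i * y j).
Proof.
move=> H x01 y01; pose f i := \sum_j N i j * y j.
pose A := [set i | f i < 0]; pose h j := \sum_(i in A) N i j.
have -> : \sum_i \sum_j N i j * (x i * y j) = \sum_i x i * f i.
  by apply: eq_bigr => i _; rewrite mulr_sumr; apply: eq_bigr => j _; ring.
apply: le_trans (sum_neg_le f x01); rewrite -/A.
have -> : \sum_(i in A) f i = \sum_j y j * h j.
  rewrite exchange_big; apply: eq_bigr => j _; rewrite mulr_sumr.
  by apply: eq_bigr => i _; rewrite mulrC.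
apply: le_trans (sum_neg_le h y01); rewrite exchange_big; exact: H.
Qed.

(** Because the total is 0, lower bounds on rectangle sums alone bound the form from above; hence a
    large form forces a rectangle of low density. *)
Lemma rect_sum_signs (R : realType) (I J : finType) (N : I -> J -> R) (l : R)
    (x : I -> R) (y : J -> R) :
  (forall A B, - l <= rect_sum N A B) -> \sum_i \sum_j N i j = 0 ->
  (forall i, -1 <= x i <= 1) -> (forall j, -1 <= y j <= 1) ->
  \sum_i \sum_j N i j * (x i * y j) <= 4 * l.
Proof.
move=> H N0 x1 y1.
have b1 : - l <= \sum_i \sum_j N i j * ((1 + x i) / 2 * ((1 - y j) / 2)).
  apply: (rect_sum_min (x := fun i => (1 + x i) / 2) (y := fun j => (1 - y j) / 2)) => // k.
    by have := x1 k => /andP[? ?]; apply/andP; split; lra.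
  by have := y1 k => /andP[? ?]; apply/andP; split; lra.
have b2 : - l <= \sum_i \sum_j N i j * ((1 - x i) / 2 * ((1 + y j) / 2)).
  apply: (rect_sum_min (x := fun i => (1 - x i) / 2) (y := fun j => (1 + y j) / 2)) => // k.
    by have := x1 k => /andP[? ?]; apply/andP; split; lra.
  by have := y1 k => /andP[? ?]; apply/andP; split; lra.
(* [x y = 1 - (1 + x) (1 - y) / 2 - (1 - x) (1 + y) / 2] *)
have -> : \sum_i \sum_j N i j * (x i * y j) = \sum_i \sum_j N i j
    - 2 * (\sum_i \sum_j N i j * ((1 + x i) / 2 * ((1 - y j) / 2)))
    - 2 * (\sum_i \sum_j N i j * ((1 - x i) / 2 * ((1 + y j) / 2))).
  rewrite !mulr_sumr -!sumrB; apply: eq_bigr => i _.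
  by rewrite !mulr_sumr -!sumrB; apply: eq_bigr => j _; field.
rewrite N0; lra.
Qed.

Definition ones (I J : finType) (M : I -> J -> bool) (A : {set I}) (B : {set J}) : nat :=
  \sum_(i in A) \sum_(j in B) M i j.

Section Amplification.
Variables (R : realType) (I J T : finType) (M : I -> J -> bool).
Variables (u : I -> T -> R) (v : J -> T -> R) (G : nat).
Hypothesis G_gt0 : (0 < G)%N.
Hypothesis uG : forall i, dot (u i) (u i) <= G%:R.
Hypothesis vG : forall j, dot (v j) (v j) <= G%:R.
Hypothesis uvM : forall i j, dot (u i) (v j) = (M i j)%:R.

Definition area (A : {set I}) (B : {set J}) : R := #|A|%:R * #|B|%:R.

(** Let [N] be [M - p] on [A x B], of total 0, and [- l] its least rectangle sum. Grothendieck's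
    inequality, tested on [u] and [v], gives [(1 - p) p area / G <= 8 (4 l)], and [1 - p >= 1/2]
    yields the constant 64. *)
Lemma density_decrement (A : {set I}) (B : {set J}) (p : R) :
  (ones M A B)%:R = p * area A B -> 0 <= p <= 1 / 2 ->
  exists A' B', (ones M A' B')%:R
     <= p * area A' B' - p * area A B / (64 * G%:R).
Proof.
move=> pE /andP[p0 p12].
pose N i j : R := (i \in A)%:R * (j \in B)%:R * ((M i j)%:R - p).
have NE A' B' : rect_sum N A' B'
    = (ones M (A :&: A') (B :&: B'))%:R - p * area (A :&: A') (B :&: B').
  rewrite /rect_sum /ones natr_sum /area.
  have -> : p * (#|A :&: A'|%:R * #|B :&: B'|%:R) =
      \sum_(i in A :&: A') \sum_(j in B :&: B') p.
    by rewrite !sumr_const -mulrnA -[RHS]mulr_natr natrM; ring.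
  rewrite -sumrB big_mkcond [RHS]big_mkcond; apply: eq_bigr => i _.
  rewrite inE /N; case: (i \in A'); rewrite ?andbF // andbT.
  case: (i \in A); last by rewrite big1 // => j _; rewrite !mul0r.
  rewrite natr_sum -sumrB big_mkcond [RHS]big_mkcond; apply: eq_bigr => j _.
  by rewrite inE; case: (j \in B); case: (j \in B'); rewrite ?(mul0r, mulr0, mul1r).
have N0 : \sum_i \sum_j N i j = 0.
  have := NE setT setT; rewrite /rect_sum !setIT pE subrr => e; rewrite -[RHS]e.
  by apply: eq_big => [i|i _]; rewrite ?inE //; apply: eq_bigl => j; rewrite inE.
pose F (X : {set I} * {set J}) := rect_sum N X.1 X.2.
have [[A' B'] _ minF] := @arg_minP _ _ _ (set0, set0) predT F isT.
exists (A :&: A'), (B :&: B').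
pose l := - F (A', B').
have Hl X Y : - l <= rect_sum N X Y by rewrite /l opprK; exact: (minF (X, Y)).
have Hs x y := @rect_sum_signs _ _ _ N l x y Hl N0.
have G0 : 0 < G%:R :> R by rewrite ltr0n.
have := @grothendieck _ _ _ N _ Hs T G%:R^-1 u v.
have h k (z : k -> T -> R) : (forall i, dot (z i) (z i) <= G%:R) ->
    forall i, G%:R^-1 * dot (z i) (z i) <= 1.
  by move=> zG i; rewrite mulrC ler_pdivrMr // mul1r.
move=> /(_ _ (h _ _ uG) (h _ _ vG)); rewrite invr_ge0 ler0n => /(_ isT).
have -> : \sum_i \sum_j N i j * (G%:R^-1 * dot (u i) (v j)) =
    (\sum_i \sum_j N i j * (M i j)%:R) / G%:R.
  rewrite mulr_suml; apply: eq_bigr => i _; rewrite mulr_suml; apply: eq_bigr => j _.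
  by rewrite uvM; ring.
have -> : \sum_i \sum_j N i j * (M i j)%:R = (1 - p) * (ones M A B)%:R.
  rewrite /ones natr_sum mulr_sumr [RHS]big_mkcond; apply: eq_bigr => i _.
  rewrite /N; case: (i \in A); last by rewrite big1 // => j _; rewrite !mul0r.
  rewrite natr_sum mulr_sumr [RHS]big_mkcond; apply: eq_bigr => j _.
  by case: (j \in B); case: (M i j); rewrite ?(mulr0, mul0r, mul1r, mulr1).
rewrite pE ler_pdivrMr // => HH.
have a0 : 0 <= area A B by rewrite mulr_ge0.
have := NE A' B'; rewrite -[rect_sum _ _ _]/(F (A', B')) => FE.
suff : p * area A B / (64 * G%:R) <= l by rewrite /l FE; lra.
rewrite ler_pdivrMr ?mulr_gt0 //.
have : 0 <= p * area A B by rewrite mulr_ge0.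
nra.
Qed.

(** With [K = 64 G], a decrement that multiplies the density by at most [1 - x] keeps a fraction
    [1 / (K x)] of the area, and [(1 - x)^K (1 + K x) <= 1] by Bernoulli; this fixes the exponent.
    The last decrement, which crosses [eps], costs the divisor [K]. *)
Lemma sparse_rectangle (eps : R) : 0 < eps <= 1 ->
  (0 < #|I|)%N -> (0 < #|J|)%N ->
  (ones M setT setT)%:R <= 1 / 2 * area setT setT ->
  exists A B, (ones M A B)%:R <= eps * area A B /\
    area setT setT * (eps ^+ (64 * G) / (64 * G%:R)) <= area A B.
Proof.
move=> /andP[e0 e1] I0 J0 dM.
have n0 : 0 < area setT setT by rewrite mulr_gt0 // ltr0n cardsT.
have G1 : 1 <= G%:R :> R by rewrite ler1n.
have K0 : 0 < 64 * G%:R :> R by lra.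
pose dens (X : {set I} * {set J}) : R := (ones M X.1 X.2)%:R / area X.1 X.2.
(* Among the rectangles of density above [eps] whose area has not shrunk by more
   than the [64 G]-th power of their density, take one of least density. *)
pose Q (X : {set I} * {set J}) := (eps < dens X) && (0 < area X.1 X.2) &&
  (area setT setT * dens X ^+ (64 * G) <= area X.1 X.2).
have densT : dens (setT, setT) <= 1 / 2 by rewrite ler_pdivrMr.
have dens0 X : 0 <= dens X by rewrite divr_ge0 // mulr_ge0.
have [dT|dT] := leP (dens (setT, setT)) eps.
  exists setT, setT; split; first by rewrite -ler_pdivrMr.
  apply: ler_piMr; first exact: ltW.
  rewrite ler_pdivrMr // mul1r.
  apply: le_trans (_ : 1 <= _); last by lra.
  by rewrite exprn_ile1 // ltW.
have QT : Q (setT, setT).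
  rewrite /Q dT n0 /=; apply: ler_piMr; first exact: ltW.
  by rewrite exprn_ile1 //; lra.
have [[A B] /andP[/andP[]] /=] := arg_minP dens QT.
set p := dens (A, B) => ep a0 pa minp.
have pT : p <= dens (setT, setT) by exact: minp.
have pE : (ones M A B)%:R = p * area A B by rewrite divfK ?gt_eqF.
have p0 : 0 < p by lra.
have [|A' [B' oA']] := density_decrement pE; first by apply/andP; split; lra.
have o0 : 0 <= (ones M A' B')%:R :> R by [].
(* The number of ones is nonnegative, so the decrement is at most [p * area A' B']. *)
have sig : area A B / (64 * G%:R) <= area A' B'.
  rewrite -(ler_pM2l p0); apply: le_trans (_ : p * area A B / (64 * G%:R) <= _); lra.
have a'0 : 0 < area A' B' by apply: lt_le_trans sig; rewrite divr_gt0.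
pose x := area A B / (64 * G%:R) / area A' B'.
have x0 : 0 < x by rewrite !divr_gt0.
have x1 : x <= 1 by rewrite ler_pdivrMr // mul1r.
have p' : dens (A', B') <= p * (1 - x).
  rewrite ler_pdivrMr //; apply: le_trans oA' _.
  rewrite le_eqVlt; apply/orP; left; apply/eqP; rewrite /x; field.
  by rewrite !gt_eqF //; lra.
have [d'|d'] := leP (dens (A', B')) eps.
  exists A', B'; split; first by rewrite -ler_pdivrMr.
  apply: le_trans sig; rewrite mulrA; apply: ler_wpM2r; first by rewrite invr_ge0 ltW.
  apply: le_trans pa; apply: ler_wpM2l; first exact: ltW.
  by rewrite lerXn2r ?nnegrE; lra.
(* Otherwise the new rectangle satisfies [Q] as well, although its density is below the least
   one. *)
have : p <= dens (A', B').
  apply: minp; rewrite /Q d' a'0 /=.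
  apply: le_trans (_ : area setT setT * (p * (1 - x)) ^+ (64 * G) <= _).
    apply: ler_wpM2l; first exact: ltW.
    by rewrite lerXn2r ?nnegrE // mulr_ge0; lra.
  rewrite exprMn mulrA; apply: le_trans (_ : area A B * (1 - x) ^+ (64 * G) <= _).
    by rewrite ler_wpM2r // exprn_ge0; lra.
  have bern : 1 + (64 * G%:R) * x <= (1 + x) ^+ (64 * G).
    by have := bernoulli_ineq (64 * G) (ltW x0); rewrite natrM.
  have c1 : (1 - x) ^+ (64 * G) * (1 + x) ^+ (64 * G) <= 1.
    rewrite -exprMn exprn_ile1 //; nra.
  have c2 : (1 - x) ^+ (64 * G) * (1 + (64 * G%:R) * x) <= 1.
    apply: le_trans c1; rewrite ler_wpM2l // exprn_ge0; lra.
  have c0 : 0 <= (1 - x) ^+ (64 * G) by rewrite exprn_ge0; lra.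
  have -> : area A B = area A' B' * (64 * G%:R * x).
    by rewrite /x; field; rewrite !gt_eqF //; lra.
  set z := _ ^+ _ in c0 c2 *; rewrite -mulrA; apply: ler_piMr; first exact: ltW.
  lra.
have := mulr_gt0 p0 x0; lra.
Qed.

End Amplification.

(** * Lowering the norms of the rows of a cell *)

Section Dot.
Variables (R : realType) (T : finType).
Implicit Types x y z : T -> R.

Lemma dotC x y : dot x y = dot y x.
Proof. by apply: eq_bigr => t _; rewrite mulrC. Qed.

Lemma dot_ge0 x : 0 <= dot x x.
Proof. by apply: sumr_ge0 => t _; rewrite -expr2 sqr_ge0. Qed.

Lemma dotDl x y z : dot (fun t => x t + y t) z = dot x z + dot y z.
Proof. by rewrite /dot -big_split; apply: eq_bigr => t _; rewrite mulrDl. Qed.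

Lemma dotZl a x z : dot (fun t => a * x t) z = a * dot x z.
Proof. by rewrite /dot mulr_sumr; apply: eq_bigr => t _; rewrite mulrA. Qed.

(** The Cauchy-Schwarz inequality, from Lagrange's identity. *)
Lemma dot_sqr_le x y : dot x y ^+ 2 <= dot x x * dot y y.
Proof.
have : 0 <= \sum_s \sum_t (x s * y t - x t * y s) ^+ 2.
  by apply: sumr_ge0 => s _; apply: sumr_ge0 => t _; exact: sqr_ge0.
have -> : \sum_s \sum_t (x s * y t - x t * y s) ^+ 2 =
    dot x x * dot y y + dot y y * dot x x - 2 * (dot x y * dot x y).
  rewrite /dot !big_distrlr mulr_sumr -big_split -sumrB; apply: eq_bigr => s _ /=.
  rewrite mulr_sumr -big_split -sumrB; apply: eq_bigr => t _ /=; ring.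
by rewrite expr2; lra.
Qed.

(** The component of [x] orthogonal to [w]. *)
Definition reject w x : T -> R := fun t => x t + - (dot x w / dot w w) * w t.

Lemma dot_reject w x z : dot (reject w x) z = dot x z - dot x w / dot w w * dot w z.
Proof. by rewrite dotDl dotZl mulNr. Qed.

Lemma reject_norm w x : dot w w != 0 ->
  dot (reject w x) (reject w x) = dot x x - dot x w ^+ 2 / dot w w.
Proof.
move=> w0; rewrite dot_reject [dot x (reject _ _)]dotC [dot w (reject _ _)]dotC.
by rewrite !dot_reject [dot w x]dotC; field.
Qed.

End Dot.

Section Perceptron.
Variables (R : realType) (I T : finType) (u : I -> T -> R) (v : T -> R).
Variables (S : {set I}) (E F : R).
Hypothesis uE : forall i, i \in S -> dot (u i) (u i) <= E.
Hypothesis vF : dot v v <= F.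
Hypothesis uv1 : forall i, i \in S -> dot (u i) v = 1.

(* Perceptron: while some row of [S] has product less than [E / 2] with the
   running sum [w], add it to [w]. After [s] steps [|w|^2 <= 2 E s] while
   [<w, v> = s], so that [s <= 2 E F]. *)
Lemma perceptron : 0 < E -> 0 <= F ->
  exists (C : {set I}) (w : T -> R),
    [/\ C \subset S, #|C|%:R <= 2 * E * F, dot w w <= 4 * E ^+ 2 * F,
        forall x, (forall i, i \in C -> dot (u i) x = 0) -> dot w x = 0 &
        forall i, i \in S -> E / 2 <= dot (u i) w].
Proof.
move=> E0 F0.
match goal with |- ?P => pose goal := P end.
pose inv (s : nat) (c : seq I) (w : T -> R) :=
  [/\ size c = s, {subset c <= S}, dot w v = s%:R, dot w w <= 2 * E * s%:R &
      forall x, (forall i, i \in c -> dot (u i) x = 0) -> dot w x = 0].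
have inv_le s c w : inv s c w -> s%:R <= 2 * E * F.
  case=> _ _ wv ww _; have := dot_sqr_le w v; rewrite wv.
  have [->|s0] := posnP s; first by rewrite !mulr_ge0 // ltW.
  have s1 : 0 < s%:R :> R by rewrite ltr0n.
  move=> h; rewrite -(ler_pM2l s1) -expr2; apply: le_trans h _.
  apply: le_trans (_ : 2 * E * s%:R * F <= _); last lra.
  by apply: ler_pM; rewrite // dot_ge0.
(* By [inv_le] the invariant fails after more than [2 E F] steps, so the goal is reached before. *)
suff step s : goal \/ exists c w, inv s c w.
  have [//|[c [w /inv_le b2]]] := step (Num.bound (2 * E * F)).
  have b1 : 2 * E * F < (Num.bound (2 * E * F))%:R.
    by apply: archi_boundP; rewrite !mulr_ge0 // ltW.
  by have := lt_le_trans b1 b2; rewrite ltxx.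
elim: s => [|s [gl|[c [w iv]]]]; [|by left|].
  right; exists [::], (fun=> 0); have dot0 x : dot (fun=> 0) x = 0 :> R.
    by rewrite /dot big1 // => t _; rewrite mul0r.
  by split; rewrite ?dot0 ?mulr0.
have [cs cS wv ww cw] := iv.
have [/forallP allS|] := boolP [forall i, (i \in S) ==> (E / 2 <= dot (u i) w)].
  left; exists [set i in c], w; split.
  - by apply/subsetP => i; rewrite inE; exact: cS.
  - apply: le_trans (inv_le _ _ _ iv).
    by rewrite ler_nat -cs cardsE card_size.
  - apply: le_trans ww _; have := inv_le _ _ _ iv.
    by move/(ler_wpM2l (_ : 0 <= 2 * E)) => /(_ ltac:(lra)); lra.
  - by move=> x cx; apply: cw => i ic; apply: cx; rewrite inE.
  - by move=> i iS; have := allS i; rewrite iS.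
rewrite negb_forall => /existsP[i]; rewrite negb_imply -ltNge => /andP[iS iw].
right; exists (i :: c), (fun t => w t + u i t); split.
- by rewrite /= cs.
- by move=> k; rewrite inE => /orP[/eqP-> //|/cS].
- by rewrite dotDl wv uv1 // natr1.
(* As [dot (u i) w < E / 2], the squared norm grows by at most [2 (E / 2) + E]. *)
- rewrite dotDl [dot w _]dotC [dot (u i) _]dotC !dotDl [dot w (u i)]dotC -natr1.
  have := uE iS; lra.
- move=> x cx; rewrite dotDl cw ?cx ?addr0 ?inE ?eqxx //.
  by move=> k kc; apply: cx; rewrite inE kc orbT.
Qed.

(** Projecting off the perceptron sum [w] lowers the squared norms by at least
    [(E / 2)^2 / (4 E^2 F) = 1 / (16 F)]. Since [w] is a sum of rows in [C], a vector orthogonal to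
    these rows keeps its products. *)
Lemma cell_projection : S != set0 ->
  exists (C : {set I}) (u' : I -> T -> R),
    [/\ C \subset S, #|C|%:R <= 2 * E * F,
        forall i, i \in S -> dot (u' i) (u' i) <= E - 1 / (16 * F) &
        forall i x, (forall k, k \in C -> dot (u k) x = 0) ->
          dot (u' i) x = dot (u i) x].
Proof.
case/set0Pn => i0 i0S.
have EF : 1 <= E * F.
  have := dot_sqr_le (u i0) v; rewrite uv1 // expr1n => /le_trans; apply.
  by apply: ler_pM; rewrite ?dot_ge0 // uE.
have E0 : 0 <= E by exact: le_trans (dot_ge0 _) (uE i0S).
have F0 : 0 <= F by exact: le_trans (dot_ge0 _) vF.
have Ep : 0 < E by rewrite lt_neqAle E0 andbT; apply/eqP => e; move: EF; rewrite -e; lra.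
have Fp : 0 < F by rewrite lt_neqAle F0 andbT; apply/eqP => e; move: EF; rewrite -e; lra.
have [C [w [CS cC ww wx uw]]] := perceptron Ep F0.
have w0 : 0 < dot w w.
  rewrite lt_neqAle dot_ge0 andbT eq_sym; apply/eqP => w0.
  have := dot_sqr_le (u i0) w; rewrite w0 mulr0 => /le_gtF.
  by rewrite exprn_gt0 //; have := uw _ i0S; lra.
exists C, (fun i => reject w (u i)); split=> // [i iS|i x /wx wx0].
  rewrite reject_norm ?gt_eqF //.
  apply: lerB; first exact: uE.
  rewrite ler_pdivlMr // mulrC mulrA mulr1 ler_pdivrMr ?mulr_gt0 //.
  apply: le_trans ww _; have := uw _ iS => h.
  have : (E / 2) ^+ 2 <= dot (u i) w ^+ 2 by rewrite lerXn2r // nnegrE; lra.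
  by move/(ler_wpM2r F0); lra.
by rewrite dot_reject wx0 mulr0 subr0.
Qed.

End Perceptron.

(** * Greedy covering *)

Section Factorizations.
Variables (R : realType) (I J T : finType).

Definition short (A : {set I}) (u : I -> T -> R) (E : R) : Prop :=
  forall i, i \in A -> dot (u i) (u i) <= E.

Definition factors (M : I -> J -> bool) (A : {set I}) (B : {set J})
    (u : I -> T -> R) (v : J -> T -> R) : Prop :=
  forall i j, i \in A -> j \in B -> dot (u i) (v j) = (M i j)%:R.

Definition nbrs (M : I -> J -> bool) (B : {set J}) (i : I) := [set j in B | M i j].

(* [K] is the set of columns spoiled by the change of vectors on the rows in [A]. *)
Definition covered M (A : {set I}) (B : {set J}) (v : J -> T -> R) (E k : R) : Prop :=
  exists (K : {set J}) (u' : I -> T -> R),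
    [/\ #|K|%:R <= k * #|A|%:R, short A u' E & factors M A (B :\: K) u' v].

(** The vectors [v] stay fixed; for [tr M] the same notion shortens the column vectors instead. *)
Definition reduced M (A : {set I}) (B : {set J}) (v : J -> T -> R) (E a b : R) : Prop :=
  exists (A' : {set I}) (B' : {set J}) (u' : I -> T -> R),
    [/\ A' \subset A, B' \subset B, a <= #|A'|%:R & b <= #|B'|%:R] /\
    short A' u' E /\ factors M A' B' u' v.

End Factorizations.

Definition tr (I J : Type) (M : I -> J -> bool) : J -> I -> bool := fun j i => M i j.

Section Cover.
Variables (R : realType) (I J T : finType) (M : I -> J -> bool).
Variables (u : I -> T -> R) (v : J -> T -> R).

Implicit Types (A S : {set I}) (B : {set J}) (E F k a b d : R).

Lemma factors_tr A B : factors M A B u v -> factors (tr M) B A v u.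
Proof. by move=> f j i jB iA; rewrite dotC f. Qed.

Lemma covered0 B E k : 0 <= k -> covered M set0 B v E k.
Proof.
move=> k0; exists set0, u; split; first by rewrite !cards0 mulr0.
  by move=> i; rewrite inE.
by move=> i j; rewrite inE.
Qed.

Lemma covered_sub A B (B' : {set J}) E k : B' \subset B ->
  covered M A B v E k -> covered M A B' v E k.
Proof.
move=> BB [K [u' [cK sh f]]]; exists K, u'; split=> // i j iA.
by rewrite inE => /andP[jK jB']; apply: f; rewrite ?inE ?jK ?(subsetP BB).
Qed.

(** The new cell spoils only the columns with a one in a row of [C], as all others are orthogonal to
    these rows. There are at most [2 E F d] of them, charged to the rows of [S]. *)
Lemma covered_cell A B (j0 : J) S E F k d :
  covered M A B v (E - 1 / (16 * F)) k -> [disjoint A & S] -> S != set0 ->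
  short S u E -> dot (v j0) (v j0) <= F -> factors M S B u v ->
  (forall i, i \in S -> dot (u i) (v j0) = 1) ->
  (forall i, i \in S -> #|nbrs M B i|%:R <= d) -> 2 * E * F * d <= k * #|S|%:R ->
  covered M (A :|: S) B v (E - 1 / (16 * F)) k.
Proof.
move=> [K [u' [cK sh f]]] dis S0 uE vF fS uv1 deg kS.
have [C [w [CS cC wE wx]]] := cell_projection uE vF uv1 S0.
have [i0 i0S] := set0Pn _ S0.
have d0 : 0 <= d by apply: le_trans (deg i0 i0S).
exists (K :|: \bigcup_(i in C) nbrs M B i), (fun i => if i \in A then u' i else w i); split.
- have -> : #|A :|: S| = (#|A| + #|S|)%N by apply/eqP; rewrite (leq_card_setU A S).2.
  rewrite natrD mulrDr; apply: (@le_trans _ _ (#|K| + #|\bigcup_(i in C) nbrs M B i|)%:R).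
    by rewrite ler_nat leq_card_setU.
  rewrite natrD; apply: lerD => //; apply: le_trans kS.
  apply: (@le_trans _ _ (#|C|%:R * d)); last by rewrite ler_wpM2r.
  rewrite [leRHS]mulr_natl -[leRHS]sumr_const.
  apply: (@le_trans _ _ (\sum_(i in C) #|nbrs M B i|)%:R); last first.
    by rewrite natr_sum; apply: ler_sum => i /(subsetP CS); exact: deg.
  rewrite ler_nat; elim/big_rec2: _ => [|i X m _ IH]; first by rewrite cards0.
  by apply: leq_trans (leq_card_setU _ _) _; rewrite leq_add2l.
- move=> i; rewrite inE; case: ifP => [/sh //|_ /= iS]; exact: wE.
- move=> i j; rewrite !inE => iAS /andP[]; rewrite negb_or => /andP[jK jC] jB.
  case: ifP iAS => [iA _|iA /= iS]; first by apply: f; rewrite ?inE ?jK.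
  rewrite wx; first exact: fS.
  move=> k' k'C; rewrite fS ?(subsetP CS) //.
  case Mkj: (M k' j) => //; case/negP: jC; apply/bigcupP; exists k' => //.
  by rewrite inE jB.
Qed.

Lemma covered_reduced A (A0 : {set I}) B (B0 : {set J}) E k a b :
  A \subset A0 -> B \subset B0 -> covered M A B v E k ->
  a <= #|A|%:R -> b + k * #|A|%:R <= #|B|%:R -> reduced M A0 B0 v E a b.
Proof.
move=> AA BB [K [u' [cK sh f]]] aA bB; exists A, (B :\: K), u'.
split=> //; split=> //; first exact: subset_trans (subsetDl _ _) BB.
have : (#|B| <= #|B :\: K| + #|K|)%N.
  by rewrite -(cardsID K B) addnC leq_add2l subset_leq_card ?subsetIr.
rewrite -(ler_nat R) natrD; lra.
Qed.

End Cover.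

(* That [a] has the largest relative degree in [A1 x B1] bounds the degrees of the
   rows of its cell, hence the number of columns spoiled by the perceptron. *)
Lemma greedy_move (R : realType) (I J T : finType) (M : I -> J -> bool)
    (u : I -> T -> R) (v : J -> T -> R) (A A1 : {set I}) (B B1 : {set J}) (E F G : R) a :
  A1 \subset A -> B1 \subset B -> a \in B1 -> (0 < #|A|)%N ->
  short A u E -> short B v F -> E <= G -> F <= G -> factors M A B u v ->
  nbrs (tr M) A1 a != set0 ->
  (forall i, i \in A1 -> (#|nbrs M B1 i| * #|A| <= #|nbrs (tr M) A1 a| * #|B|)%N) ->
  covered M (A :\: A1) B1 v (E - 1 / (16 * G)) (2 * G ^+ 2 * #|B|%:R / #|A|%:R) ->
  covered M (A :\: (A1 :\: nbrs (tr M) A1 a)) B1 v (E - 1 / (16 * G))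
    (2 * G ^+ 2 * #|B|%:R / #|A|%:R).
Proof.
move=> AA BB aB A0 uE vF EG FG f S0 deg cov.
set S := nbrs _ _ _ in S0 deg *.
have SA1 : S \subset A1 by apply/subsetP => i; rewrite inE => /andP[].
have SA := subset_trans SA1 AA.
have -> : A :\: (A1 :\: S) = (A :\: A1) :|: S.
  apply/setP => i; rewrite in_setU !in_setD negb_and negbK.
  by case: (boolP (i \in S)) => [/(subsetP SA)->|_]; rewrite ?orbT ?orbF.
have m0 : 0 < #|A|%:R :> R by rewrite ltr0n.
have aB' := subsetP BB _ aB.
have uv1 i : i \in S -> dot (u i) (v a) = 1.
  move=> iS; rewrite f ?(subsetP SA) //.
  by move: iS; rewrite inE => /andP[_]; rewrite /tr => ->.
have [i0 i0S] := set0Pn _ S0.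
have E0 : 0 <= E by apply: le_trans (dot_ge0 _) (uE _ (subsetP SA _ i0S)).
have F0 : 0 <= F by apply: le_trans (dot_ge0 _) (vF _ aB').
apply: (@covered_cell _ _ _ _ M u v _ _ a S E G _ (#|S|%:R * #|B|%:R / #|A|%:R)) => //.
- rewrite -setI_eq0; apply/eqP/setP => i; rewrite !inE.
  by case: (i \in A1); rewrite ?andbF //= andbF.
- by move=> i /(subsetP SA); exact: uE.
- exact: le_trans (vF _ aB') FG.
- by move=> i j iS jB; apply: f; [exact: (subsetP SA)|exact: (subsetP BB)].
- by move=> i /(subsetP SA1) /deg; rewrite ler_pdivlMr // -!natrM ler_nat.
- have -> : 2 * G ^+ 2 * #|B|%:R / #|A|%:R * #|S|%:R =
    2 * G * G * (#|S|%:R * #|B|%:R / #|A|%:R) by ring.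
  apply: ler_wpM2r; first by rewrite !mulr_ge0 // invr_ge0.
  apply: ler_wpM2r; [exact: le_trans F0 FG|lra].
Qed.

(** A cell has at most [eta #|A|] rows, so at most [2 eta #|A|] rows are covered when the threshold
    is passed. Then at most [4 G^2 eta #|B| = #|B| / 8] columns are spoiled and fewer than
    [#|B| / 32] lie outside [B1], so half of them survive. *)
Lemma greedy_step (R : realType) (I J T : finType) (M : I -> J -> bool)
    (u : I -> T -> R) (v : J -> T -> R) (A A1 : {set I}) (B B1 : {set J}) (E F G eta : R) a :
  A1 \subset A -> B1 \subset B -> a \in B1 -> (0 < #|A|)%N ->
  short A u E -> short B v F -> E <= G -> F <= G -> factors M A B u v ->
  nbrs (tr M) A1 a != set0 ->
  (forall i, i \in A1 -> (#|nbrs M B1 i| * #|A| <= #|nbrs (tr M) A1 a| * #|B|)%N) ->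
  eta * (32 * G ^+ 2) = 1 -> eta <= 1 / 32 ->
  #|A :\: A1|%:R < eta * #|A|%:R -> #|B :\: B1|%:R < eta * #|B|%:R ->
  #|nbrs (tr M) A a|%:R <= eta * #|A|%:R ->
  let A2 := A1 :\: nbrs (tr M) A1 a in
  let E' := E - 1 / (16 * G) in let k := 2 * G ^+ 2 * #|B|%:R / #|A|%:R in
  covered M (A :\: A1) B1 v E' k ->
  reduced M A B v E' (eta * #|A|%:R) (#|B|%:R / 2) \/
  #|A :\: A2|%:R < eta * #|A|%:R /\ covered M (A :\: A2) B1 v E' k.
Proof.
move=> AA BB aB A0 uE vF EG FG f S0 deg etaE eta1 cA cB cS A2 E' k covA.
have cov2 := greedy_move AA BB aB A0 uE vF EG FG f S0 deg covA.
have [big|small] := leP (eta * #|A|%:R) #|A :\: A2|%:R; [left|by right].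
apply: covered_reduced cov2 _ _ => //; first exact: subsetDl.
have m0 : 0 < #|A|%:R :> R by rewrite ltr0n.
have sizeB : #|B|%:R = #|B1|%:R + #|B :\: B1|%:R :> R.
  by rewrite -natrD -(cardsID B1 B) (setIidPr BB).
have cA2 : #|A :\: A2|%:R <= 2 * (eta * #|A|%:R) :> R.
  apply: (@le_trans _ _ (#|A :\: A1| + #|nbrs (tr M) A a|)%:R); last by rewrite natrD; lra.
  rewrite ler_nat; apply: leq_trans (leq_card_setU _ _); apply: subset_leq_card.
  apply/subsetP => i; rewrite !inE negb_and negbK.
  by case: (i \in A1); case: (i \in A); case: (tr M a i).
have q0 : 0 <= #|B|%:R :> R by [].
have kA : k * #|A :\: A2|%:R <= #|B|%:R / 8.
  apply: (@le_trans _ _ (k * (2 * (eta * #|A|%:R)))).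
    apply: ler_wpM2l cA2; rewrite /k divr_ge0 // mulr_ge0 // mulr_ge0 //. exact: sqr_ge0.
  have -> : k * (2 * (eta * #|A|%:R)) = eta * (32 * G ^+ 2) * (#|B|%:R / 8).
    by rewrite /k; field; rewrite gt_eqF.
  by rewrite etaE mul1r.
have : eta * #|B|%:R <= 1 / 32 * #|B|%:R by rewrite ler_wpM2r.
move: kA; rewrite /k; lra.
Qed.

Definition zero_sub (R : realType) (I J : finType) (M : I -> J -> bool)
    (A : {set I}) (B : {set J}) (a b : R) : Prop :=
  exists (A0 : {set I}) (B0 : {set J}),
    [/\ A0 \subset A, B0 \subset B, a <= #|A0|%:R, b <= #|B0|%:R &
        forall i j, i \in A0 -> j \in B0 -> M i j = false].

Lemma card_diff (T : finType) (A S : {set T}) :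
  S \subset A -> S != set0 -> (#|A :\: S| < #|A|)%N.
Proof.
move=> SA S0; rewrite cardsDS // ltn_subrL card_gt0 S0 /=.
by apply: leq_trans (subset_leq_card SA); rewrite card_gt0.
Qed.

Section Greedy.
Variables (R : realType) (I J T : finType) (M : I -> J -> bool).
Variables (u : I -> T -> R) (v : J -> T -> R) (A : {set I}) (B : {set J}) (E F G eta : R).
Hypothesis A_gt0 : (0 < #|A|)%N.
Hypothesis B_gt0 : (0 < #|B|)%N.
Hypothesis uE : short A u E.
Hypothesis vF : short B v F.
Hypothesis EG : E <= G.
Hypothesis FG : F <= G.
Hypothesis G_ge1 : 1 <= G.
Hypothesis uvM : factors M A B u v.
Hypothesis etaE : eta * (32 * G ^+ 2) = 1.
Hypothesis deg_row : forall i, i \in A -> #|nbrs M B i|%:R <= eta * #|B|%:R.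
Hypothesis deg_col : forall j, j \in B -> #|nbrs (tr M) A j|%:R <= eta * #|A|%:R.

Definition progress : Prop :=
  [\/ zero_sub M A B (#|A|%:R / 2 : R) (#|B|%:R / 2),
      reduced M A B v (E - 1 / (16 * G)) (eta * #|A|%:R) (#|B|%:R / 2) |
      reduced (tr M) B A u (F - 1 / (16 * G)) (eta * #|B|%:R) (#|A|%:R / 2)].

(** Rows and columns are covered in parallel, [A1] and [B1] being what is left, by induction on
    their total size. If [A1 x B1] has no ones, it is the zero rectangle, since the covered
    fractions are below [eta]; otherwise the line of largest relative degree gives the next cell. *)
Lemma greedy_covering : progress.
Proof.
have G2 : 1 <= G ^+ 2 by rewrite exprn_ege1.
have eta0 : 0 < eta by rewrite -(@pmulr_lgt0 _ (32 * G ^+ 2)) ?etaE //; lra.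
have eta1 : eta <= 1 / 32.
  have := ler_wpM2l (ltW eta0) G2; move: etaE; rewrite mulr1 mulrCA. lra.
have m0 : 0 < #|A|%:R :> R by rewrite ltr0n.
have q0 : 0 < #|B|%:R :> R by rewrite ltr0n.
have etam : eta * #|A|%:R <= 1 / 32 * #|A|%:R by rewrite ler_pM2r.
have etaq : eta * #|B|%:R <= 1 / 32 * #|B|%:R by rewrite ler_pM2r.
have k0 (a b : R) : 0 < a -> 0 < b -> 0 <= 2 * G ^+ 2 * a / b.
  by move=> a0 b0; rewrite divr_ge0 // ?ltW // mulr_gt0 // mulr_gt0 //; lra.
suff aux n (A1 : {set I}) (B1 : {set J}) : (#|A1| + #|B1| <= n)%N ->
  A1 \subset A -> B1 \subset B ->
  covered M (A :\: A1) B1 v (E - 1 / (16 * G)) (2 * G ^+ 2 * #|B|%:R / #|A|%:R) ->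
  covered (tr M) (B :\: B1) A1 u (F - 1 / (16 * G)) (2 * G ^+ 2 * #|A|%:R / #|B|%:R) ->
  #|A :\: A1|%:R < eta * #|A|%:R -> #|B :\: B1|%:R < eta * #|B|%:R -> progress.
  apply: (aux _ A B (leqnn _)) => //; rewrite setDv.
  - by apply: (covered0 M u); exact: k0.
  - by apply: (covered0 (tr M) v); exact: k0.
  - by rewrite cards0 mulr_gt0.
  - by rewrite cards0 mulr_gt0.
elim: n A1 B1 => [|n IH] A1 B1 leAB AA BB covA covB cA cB.
  (* All rows would be covered, against the bound [cA]. *)
  have : A1 == set0 by rewrite -cards_eq0 -leqn0 (leq_trans _ leAB) ?leq_addr.
  by move/eqP => A10; move: cA; rewrite A10 setD0; lra.
have sizeA : #|A|%:R = #|A1|%:R + #|A :\: A1|%:R :> R.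
  by rewrite -natrD -(cardsID A1 A) (setIidPr AA).
have sizeB : #|B|%:R = #|B1|%:R + #|B :\: B1|%:R :> R.
  by rewrite -natrD -(cardsID B1 B) (setIidPr BB).
have [zero|] := boolP [forall i, forall j, ~~ [&& i \in A1, j \in B1 & M i j]].
  apply: Or31; exists A1, B1; split=> //; [lra|lra|].
  move=> i j iA jB; apply/negbTE; have /forallP/(_ i)/forallP/(_ j) := zero.
  by rewrite iA jB.
rewrite negb_forall => /existsP[i0]; rewrite negb_forall => /existsP[j0].
rewrite negbK => /and3P[i0A j0B Mij].
have [i1 i1A maxi] := arg_maxnP (fun i => #|nbrs M B1 i|) i0A.
have [j1 j1B maxj] := arg_maxnP (fun j => #|nbrs (tr M) A1 j|) j0B.
have Si1 : nbrs M B1 i1 != set0.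
  rewrite -card_gt0; apply: leq_trans (maxi _ i0A).
  by apply/card_gt0P; exists j0; rewrite inE j0B.
have Sj1 : nbrs (tr M) A1 j1 != set0.
  rewrite -card_gt0; apply: leq_trans (maxj _ j0B).
  by apply/card_gt0P; exists i0; rewrite inE i0A.
(* The relative degrees, over [#|B|] for rows and [#|A|] for columns, are compared by
   cross-multiplication. *)
have [le|/ltnW le] := leqP (#|nbrs M B1 i1| * #|A|) (#|nbrs (tr M) A1 j1| * #|B|).
- have deg i (iA : i \in A1) := leq_trans (leq_mul (maxi i iA) (leqnn _)) le.
  have [red|[cA2 cov2]] := greedy_step AA BB j1B A_gt0 uE vF EG FG uvM Sj1 deg etaE eta1
    cA cB (deg_col (subsetP BB _ j1B)) covA; first exact: Or32.
  have A21 : A1 :\: nbrs (tr M) A1 j1 \subset A1 by exact: subsetDl.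
  apply: IH cov2 (covered_sub A21 covB) _ _ => //; last exact: subset_trans AA.
  rewrite -ltnS (leq_trans _ leAB) // ltn_add2r; apply: card_diff => //.
  by apply/subsetP => k; rewrite inE => /andP[].
- have deg j (jB : j \in B1) := leq_trans (leq_mul (maxj j jB) (leqnn _)) le.
  have [red|[cB2 cov2]] := greedy_step BB AA i1A B_gt0 vF uE FG EG (factors_tr uvM) Si1 deg
    etaE eta1 cB cA (deg_row (subsetP AA _ i1A)) covB; first exact: Or33.
  have B21 : B1 :\: nbrs M B1 i1 \subset B1 by exact: subsetDl.
  apply: IH (covered_sub B21 covA) cov2 _ _ => //; last exact: subset_trans BB.
  rewrite -ltnS (leq_trans _ leAB) // ltn_add2l; apply: card_diff => //.
  by apply/subsetP => k; rewrite inE => /andP[].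
Qed.

End Greedy.

(** * Zero rectangles in sparse matrices *)

Section Ones.
Variables (I J : finType) (M : I -> J -> bool).
Implicit Types (A : {set I}) (B : {set J}).

Lemma ones_row A B : ones M A B = \sum_(i in A) #|nbrs M B i|.
Proof.
apply: eq_bigr => i _; rewrite -sum1_card big_mkcond [RHS]big_mkcond.
by apply: eq_bigr => j _; rewrite inE; case: (j \in B); case: (M i j).
Qed.

Lemma ones_tr A B : ones M A B = ones (tr M) B A.
Proof. exact: exchange_big. Qed.

Lemma ones_subl A (A' : {set I}) B : A' \subset A -> (ones M A' B <= ones M A B)%N.
Proof.
move=> AA; rewrite /ones [leqLHS]big_mkcond [leqRHS]big_mkcond; apply: leq_sum => i _.
by case: ifP => // /(subsetP AA)->.
Qed.

Lemma nbrs_sub B (B' : {set J}) i : B' \subset B -> (#|nbrs M B' i| <= #|nbrs M B i|)%N.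
Proof.
move=> BB; apply: subset_leq_card; apply/subsetP => j.
by rewrite !inE => /andP[/(subsetP BB)-> ->].
Qed.

Lemma ones_le (R : realType) A B (d : R) :
  (forall i, i \in A -> #|nbrs M B i|%:R <= d) -> (ones M A B)%:R <= d * #|A|%:R.
Proof. by move=> h; rewrite ones_row natr_sum mulr_natr -sumr_const; exact: ler_sum. Qed.

End Ones.

(** Markov's inequality. *)
Lemma markov_half (R : realType) (I : finType) (A : {set I}) (f : I -> nat) (c : R) :
  0 < c -> (\sum_(i in A) f i)%:R <= c * #|A|%:R ->
  #|A|%:R <= 2 * #|[set i in A | (f i)%:R <= 2 * c]|%:R :> R.
Proof.
move=> c0 fc; set A1 := [set i in A | _].
have A1A : A1 \subset A by apply/subsetP => i; rewrite inE => /andP[].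
have : 2 * c * #|A :\: A1|%:R <= c * #|A|%:R.
  apply: le_trans fc; rewrite mulr_natr -sumr_const natr_sum.
  rewrite [leLHS]big_mkcond [leRHS]big_mkcond; apply: ler_sum => i _.
  by rewrite !inE; case: (i \in A); rewrite ?andbF //= andbT -ltNge; case: ltP => // /ltW.
have : #|A|%:R = #|A1|%:R + #|A :\: A1|%:R :> R.
  by rewrite -natrD -(cardsID A1 A) (setIidPr A1A).
by move=> -> h; rewrite -(ler_pM2l c0); lra.
Qed.

Section Sparse.
Variables (R : realType) (I J T : finType) (M : I -> J -> bool) (G eta : R).
Hypothesis G_ge1 : 1 <= G.
Hypothesis etaE : eta * (32 * G ^+ 2) = 1.
Implicit Types (A : {set I}) (B : {set J}).

(** Rows of degree above [2 d #|B|] go first, which at most doubles the density; then columns are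
    pruned against the remaining rows. Losing half of [B] at most doubles the relative degrees of
    the rows, so both bounds end at [4 d]. *)
Lemma regularize A B (d : R) : 0 < d -> (0 < #|A|)%N -> (0 < #|B|)%N ->
  (ones M A B)%:R <= d * (#|A|%:R * #|B|%:R) ->
  exists (A1 : {set I}) (B1 : {set J}), [/\ A1 \subset A, B1 \subset B,
    #|A|%:R <= 2 * #|A1|%:R :> R & #|B|%:R <= 2 * #|B1|%:R :> R] /\
    (forall i, i \in A1 -> #|nbrs M B1 i|%:R <= 4 * d * #|B1|%:R) /\
    (forall j, j \in B1 -> #|nbrs (tr M) A1 j|%:R <= 4 * d * #|A1|%:R).
Proof.
move=> d0 A0 B0 o.
have m0 : 0 < #|A|%:R :> R by rewrite ltr0n.
have q0 : 0 < #|B|%:R :> R by rewrite ltr0n.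
pose A1 := [set i in A | #|nbrs M B i|%:R <= 2 * (d * #|B|%:R)].
have A1A : A1 \subset A by apply/subsetP => i; rewrite inE => /andP[].
have cA1 : #|A|%:R <= 2 * #|A1|%:R :> R.
  by apply: markov_half; rewrite ?mulr_gt0 // -ones_row; lra.
have m1 : 0 < #|A1|%:R :> R by lra.
pose B1 := [set j in B | #|nbrs (tr M) A1 j|%:R <= 2 * (2 * d * #|A1|%:R)].
have B1B : B1 \subset B by apply/subsetP => i; rewrite inE => /andP[].
have cB1 : #|B|%:R <= 2 * #|B1|%:R :> R.
  apply: markov_half; rewrite ?mulr_gt0 //.
  rewrite -ones_row -ones_tr; apply: (@le_trans _ _ (ones M A B)%:R).
    by rewrite ler_nat ones_subl.
  apply: le_trans o _; have : d * #|B|%:R * #|A|%:R <= d * #|B|%:R * (2 * #|A1|%:R).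
    by rewrite ler_wpM2l // mulr_ge0 // ltW.
  lra.
exists A1, B1; split; first by split.
split=> [i|j]; rewrite inE => /andP[_ h]; last lra.
apply: (@le_trans _ _ #|nbrs M B i|%:R); first by rewrite ler_nat nbrs_sub.
have := ler_wpM2l (ltW d0) cB1; lra.
Qed.

(** Induction on the number of rounds, with potential [E + F]. Regularising keeps half of each side
    and a greedy round keeps a fraction [eta] of one and half of the other, so [eta / 4] bounds the
    loss on both. *)
Lemma sparse_zero s : forall A B u v (E F d : R),
  (0 < #|A|)%N -> (0 < #|B|)%N -> short A u E -> short B v F -> factors (T := T) M A B u v ->
  E <= G -> F <= G -> E + F <= s%:R / (16 * G) ->
  0 < d -> (ones M A B)%:R <= d * (#|A|%:R * #|B|%:R) -> 4 * d * 8 ^+ s <= eta ->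
  zero_sub M A B ((eta / 4) ^+ s.+1 * #|A|%:R) ((eta / 4) ^+ s.+1 * #|B|%:R).
Proof.
have G1 := G_ge1; have G2 : 1 <= G ^+ 2 by rewrite exprn_ege1.
have eta0 : 0 < eta by rewrite -(@pmulr_lgt0 _ (32 * G ^+ 2)) ?etaE //; lra.
have eta1 : eta <= 1 / 32.
  have := ler_wpM2l (ltW eta0) G2; move: etaE; rewrite mulr1 mulrCA; lra.
have e41 n : (eta / 4) ^+ n <= 1 by rewrite exprn_ile1 //; lra.
have e40 n : 0 <= (eta / 4) ^+ n by rewrite exprn_ge0 //; lra.
elim: s => [|s IH] A B u v E F d A0 B0 uE vF f EG FG EF d0 o deta.
  (* With no rounds left [E + F <= 0], so the vectors vanish and no entry is a one. *)
  exists A, B; split=> //; try by rewrite ler_piMl.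
  move=> i j iA jB; have := f i j iA jB; case: (M i j) => // e.
  have := dot_sqr_le (u i) (v j); rewrite e expr1n.
  have := uE i iA; have := vF j jB; have := dot_ge0 (u i); have := dot_ge0 (v j).
  rewrite mul0r in EF => h1 h2 h3 h4; have -> : dot (u i) (u i) = 0 by lra.
  by rewrite mul0r lt_geF.
have [A1 [B1 [[AA BB cA cB] [dr dc]]]] := regularize d0 A0 B0 o.
have m0 : 0 < #|A|%:R :> R by rewrite ltr0n.
have q0 : 0 < #|B|%:R :> R by rewrite ltr0n.
have m1 : 0 < #|A1|%:R :> R by lra.
have q1 : 0 < #|B1|%:R :> R by lra.
have d4 : 4 * d <= eta.
  have e8 : 1 <= 8 ^+ s.+1 :> R by rewrite exprn_ege1 // ler1n.
  apply: le_trans deta; apply: ler_peMr => //; lra.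
have uE1 : short A1 u E by move=> i /(subsetP AA); exact: uE.
have vF1 : short B1 v F by move=> i /(subsetP BB); exact: vF.
have f1 : factors M A1 B1 u v.
  by move=> i j /(subsetP AA) iA /(subsetP BB); exact: f.
have dr1 i : i \in A1 -> #|nbrs M B1 i|%:R <= eta * #|B1|%:R.
  by move/dr/le_trans; apply; rewrite ler_pM2r.
have dc1 i : i \in B1 -> #|nbrs (tr M) A1 i|%:R <= eta * #|A1|%:R.
  by move/dc/le_trans; apply; rewrite ler_pM2r.
have sub (A' : {set I}) (B' : {set J}) : A' \subset A1 -> B' \subset B1 ->
  eta * #|A|%:R <= 4 * #|A'|%:R -> eta * #|B|%:R <= 4 * #|B'|%:R ->
  zero_sub M A' B' ((eta / 4) ^+ s.+1 * #|A'|%:R) ((eta / 4) ^+ s.+1 * #|B'|%:R) ->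
  zero_sub M A B ((eta / 4) ^+ s.+2 * #|A|%:R) ((eta / 4) ^+ s.+2 * #|B|%:R).
  move=> A'A B'B hA hB [X [Y [XA YB hX hY z]]]; exists X, Y; split=> //.
  - exact: subset_trans (subset_trans XA A'A) AA.
  - exact: subset_trans (subset_trans YB B'B) BB.
  - apply: le_trans hX; rewrite exprSr -mulrA ler_wpM2l //; lra.
  - apply: le_trans hY; rewrite exprSr -mulrA ler_wpM2l //; lra.
have EF' : E + F - 1 / (16 * G) <= s%:R / (16 * G).
  by move: EF; rewrite -natr1 mulrDl; lra.
have iG : 0 <= 1 / (16 * G) by rewrite divr_ge0 //; lra.
have d8 : 4 * (8 * d) * 8 ^+ s <= eta by move: deta; rewrite exprS; lra.
have [||[X [Y [XA YB hX hY z]]]|[A' [B' [u' [[AA' BB' cA' cB'] [sh' f']]]]]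
    |[B' [A' [v' [[BB' AA' cB' cA'] [sh' f']]]]]]
  := @greedy_covering _ _ _ _ M u v A1 B1 E F G eta _ _ uE1 vF1 EG FG G_ge1 f1 etaE dr1 dc1.
- by rewrite -(ltr0n R).
- by rewrite -(ltr0n R).
- exists X, Y; split=> //; [exact: subset_trans AA|exact: subset_trans BB| |].
    apply: (@le_trans _ _ (eta / 4 * #|A|%:R)); last by nra.
    by rewrite ler_wpM2r // exprS ler_piMr //; lra.
  apply: (@le_trans _ _ (eta / 4 * #|B|%:R)); last by nra.
  by rewrite ler_wpM2r // exprS ler_piMr //; lra.
- apply: (sub A' B') => //; [nra|nra|].
  have m' : 0 < #|A'|%:R :> R by nra.
  have q' : 0 < #|B'|%:R :> R by nra.
  apply: (IH A' B' u' v (E - 1 / (16 * G)) F (8 * d)) => //; rewrite -?(ltr0n R) //.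
  + by move=> j /(subsetP BB'); exact: vF1.
  + lra.
  + lra.
  + lra.
  (* Row degrees are at most [4 d #|B1|] and [#|B1| <= 2 #|B'|], whence the factor 8. *)
  + rewrite (_ : 8 * d * _ = 8 * d * #|B'|%:R * #|A'|%:R); last by ring.
    apply: ones_le => i /(subsetP AA') /dr.
    move=> h; apply: (@le_trans _ _ #|nbrs M B1 i|%:R); first by rewrite ler_nat nbrs_sub.
    by apply: le_trans h _; have := ler_wpM2l (ltW d0) cB'; lra.
- apply: (sub A' B') => //; [nra|nra|].
  have m' : 0 < #|A'|%:R :> R by nra.
  have q' : 0 < #|B'|%:R :> R by nra.
  apply: (IH A' B' u v' E (F - 1 / (16 * G)) (8 * d)) => //; rewrite -?(ltr0n R) //.
  + by move=> j /(subsetP AA'); exact: uE1.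
  + exact: (factors_tr f').
  + lra.
  + lra.
  + lra.
  + rewrite ones_tr (_ : 8 * d * _ = 8 * d * #|A'|%:R * #|B'|%:R); last by ring.
    apply: ones_le => i /(subsetP BB') /dc.
    move=> h; apply: (@le_trans _ _ #|nbrs (tr M) A1 i|%:R); first by rewrite ler_nat nbrs_sub.
    by apply: le_trans h _; have := ler_wpM2l (ltW d0) cA'; lra.
Qed.

End Sparse.

(** * Assembling the constants *)

(** In [zero_rectangle], [128 G^2] is [4 / eta] and [128 G^2 8^(32 G^2)] is [1 / eps]. Using
    [G <= 2^G] turns every factor into a power of 2; the main term of the exponent is
    [3 (32 G^2) (64 G)]. *)
Lemma size_loss_le (G : nat) : (0 < G)%N ->
  ((128 * G ^ 2 * 8 ^ (32 * G ^ 2)) ^ (64 * G) * (64 * G) *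
    (128 * G ^ 2) ^ (32 * G ^ 2).+1 <= 2 ^ (64 * 128 * G ^ 3))%N.
Proof.
move=> G0; have GX : (G <= 2 ^ G)%N by rewrite ltnW // ltn_expl.
have h1 : (128 * G ^ 2 <= 2 ^ (7 + 2 * G))%N.
  by rewrite expnD leq_mul // mulnC expnM leq_exp2r.
have h2 : (8 ^ (32 * G ^ 2) = 2 ^ (3 * (32 * G ^ 2)))%N by rewrite (expnM 2 3).
have h3 : (64 * G <= 2 ^ (6 + G))%N by rewrite expnD leq_mul.
apply: (@leq_trans (2 ^ ((7 + 2 * G + 3 * (32 * G ^ 2)) * (64 * G) + (6 + G)
   + (7 + 2 * G) * (32 * G ^ 2).+1))).
  rewrite expnD [(2 ^ (_ + (6 + G)))%N]expnD; apply: leq_mul; first apply: leq_mul => //.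
    by rewrite [leqRHS]expnM leq_exp2r ?muln_gt0 // expnD h2 leq_mul.
  by rewrite [leqRHS]expnM leq_exp2r.
by rewrite leq_exp2l //; nia.
Qed.

Lemma zero_rectangle (R : realType) (I J T : finType) (M : I -> J -> bool)
    (u : I -> T -> R) (v : J -> T -> R) (G : nat) :
  (0 < #|I|)%N -> (0 < #|J|)%N -> (0 < G)%N ->
  (forall i, dot (u i) (u i) <= G%:R) -> (forall j, dot (v j) (v j) <= G%:R) ->
  (forall i j, dot (u i) (v j) = (M i j)%:R) ->
  (ones M setT setT)%:R <= 1 / 2 * area R [set: I] [set: J] ->
  zero_sub M setT setT (#|I|%:R / 2 ^+ (64 * 128 * G ^ 3) : R)
    (#|J|%:R / 2 ^+ (64 * 128 * G ^ 3)).
Proof.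
move=> I0 J0 G0 uG vG uvM half.
have G1 : 1 <= G%:R :> R by rewrite ler1n.
(* [E + F = 2 G] drops by [1 / (16 G)] in each of the [s] rounds, and [eps] leaves
   room for the density to grow by a factor [8] in each. *)
pose s := (32 * G ^ 2)%N.
pose eta : R := 1 / (32 * G%:R ^+ 2).
pose eps : R := 1 / (128 * G%:R ^+ 2 * 8 ^+ s).
have G2 : 1 <= G%:R ^+ 2 :> R by rewrite exprn_ege1.
have e8 : 1 <= 8 ^+ s :> R by rewrite exprn_ege1 // ler1n.
have eps01 : 0 < eps <= 1.
  have h : 1 <= 128 * G%:R ^+ 2 * 8 ^+ s :> R.
    by apply: (@le_trans _ _ (1 * 1)); [lra|apply: ler_pM => //; lra].
  have h0 : 0 < 128 * G%:R ^+ 2 * 8 ^+ s :> R by lra.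
  by apply/andP; split; [rewrite divr_gt0|rewrite ler_pdivrMr // mul1r].
have [A [B [oAB aAB]]] := sparse_rectangle G0 uG vG uvM eps01 I0 J0 half.
have etaE : eta * (32 * G%:R ^+ 2) = 1 by rewrite /eta divfK // gt_eqF //; lra.
set z := _ / _ in aAB.
have z0 : 0 < z.
  by have /andP[? _] := eps01; rewrite divr_gt0 ?exprn_gt0 // mulr_gt0 // ltr0n.
have i0 : 0 < #|I|%:R :> R by rewrite ltr0n.
have j0 : 0 < #|J|%:R :> R by rewrite ltr0n.
rewrite /area !cardsT in aAB.
(* A fraction [z] of the area forces a fraction [z] of each side. *)
have Az : #|I|%:R * z <= #|A|%:R.
  rewrite -(ler_pM2r j0); apply: le_trans (_ : #|A|%:R * #|B|%:R <= _); first lra.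
  by rewrite ler_wpM2l // ler_nat max_card.
have Bz : #|J|%:R * z <= #|B|%:R.
  rewrite -(ler_pM2l i0); apply: le_trans (_ : #|A|%:R * #|B|%:R <= _); first lra.
  by rewrite ler_wpM2r // ler_nat max_card.
have A0 : (0 < #|A|)%N by rewrite -(ltr0n R); apply: lt_le_trans Az; rewrite mulr_gt0.
have B0 : (0 < #|B|)%N by rewrite -(ltr0n R); apply: lt_le_trans Bz; rewrite mulr_gt0.
have [X [Y [_ _ cX cY zero]]] : zero_sub M A B
    ((eta / 4) ^+ s.+1 * #|A|%:R) ((eta / 4) ^+ s.+1 * #|B|%:R).
  have /andP[eps0 _] := eps01.
  apply: (@sparse_zero _ _ _ _ M G%:R eta G1 etaE s A B u v G%:R G%:R eps) => //.
  - rewrite ler_pdivlMr; last lra.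
    by rewrite /s natrM natrX; lra.
  - have g0 : G%:R ^+ 2 != 0 :> R by rewrite gt_eqF //; lra.
    have g8 : 8 ^+ s != 0 :> R by rewrite gt_eqF //; lra.
    rewrite le_eqVlt /eta /eps; apply/orP; left; apply/eqP; field.
    by rewrite ?g0 ?g8 //= gt_eqF //; lra.
have key : (2 ^+ (64 * 128 * G ^ 3))^-1 <= (eta / 4) ^+ s.+1 * z.
  have -> : (eta / 4) ^+ s.+1 * z = (((128 * G ^ 2 * 8 ^ s) ^ (64 * G) * (64 * G) *
    (128 * G ^ 2) ^ s.+1)%:R)^-1.
    have -> : eta / 4 = (128 * G ^ 2)%:R^-1.
      by rewrite /eta natrM natrX; field; rewrite gt_eqF //; lra.
    have epsE : eps = (128 * G ^ 2 * 8 ^ s)%:R^-1.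
      by rewrite /eps !natrM !natrX div1r.
    by rewrite /z epsE !exprVn -!natrX -natrM -!invfM -!natrM mulnC.
  rewrite lef_pV2 ?posrE ?exprn_gt0 //; last first.
    by rewrite ltr0n !muln_gt0 !expn_gt0 !muln_gt0 !expn_gt0 G0.
  by rewrite -natrX ler_nat size_loss_le.
have e0 : 0 <= (eta / 4) ^+ s.+1.
  by rewrite exprn_ge0 // !divr_ge0 // mulr_ge0 // sqr_ge0.
exists X, Y; split=> //.
- apply: le_trans cX; apply: le_trans (ler_wpM2l e0 Az).
  by rewrite mulrCA ler_wpM2l // ltW.
- apply: le_trans cY; apply: le_trans (ler_wpM2l e0 Bz).
  by rewrite mulrCA ler_wpM2l // ltW.
Qed.

(** * From a bound on [gamma2] to vectors, and from rectangles to squares *)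

Lemma exists_subset_card (T : finType) (A : {set T}) t : (t <= #|A|)%N ->
  exists2 B : {set T}, B \subset A & #|B| = t.
Proof.
move=> tA; exists [set x in take t (enum A)].
  by apply/subsetP => x; rewrite inE => /mem_take; rewrite mem_enum.
rewrite cardsE (card_uniqP _) ?take_uniq ?enum_uniq // size_take -cardE.
by case: ltnP => // At; apply/eqP; rewrite eqn_leq At.
Qed.

Section Norms.
Variables (R : realType) (k : nat).

Lemma dot_row_norm m (U : 'M[R]_(m, k)) i : dot (U i) (U i) <= row_norm U ^+ 2.
Proof.
have -> : dot (U i) (U i) = Num.sqrt (\sum_(j < k) U i j ^+ 2) ^+ 2.
  by rewrite sqr_sqrtr; [apply: eq_bigr => j _; rewrite expr2|
    apply: sumr_ge0 => j _; exact: sqr_ge0].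
have h : Num.sqrt (\sum_(j < k) U i j ^+ 2) <= row_norm U.
  exact: (le_bigmax 0 (fun i => Num.sqrt (\sum_(j < k) U i j ^+ 2))).
by rewrite lerXn2r // nnegrE ?sqrtr_ge0 // (le_trans _ h) // sqrtr_ge0.
Qed.

Lemma col_norm_tr n (V : 'M[R]_(k, n)) : col_norm V = row_norm V^T.
Proof.
by apply: eq_bigr => j _; congr Num.sqrt; apply: eq_bigr => i _; rewrite mxE.
Qed.

End Norms.

(* Rescaling [U] and [V] by reciprocal factors balances the two norms. *)
Lemma gamma2_vectors (R : realType) (m n : nat) (M : 'M[R]_(m, n)) (g : R) :
  0 < g -> gamma2 M < g -> exists (k : nat) (u : 'I_m -> 'I_k -> R) (v : 'I_n -> 'I_k -> R),
    [/\ forall i, dot (u i) (u i) <= g, forall j, dot (v j) (v j) <= g &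
        forall i j, dot (u i) (v j) = M i j].
Proof.
move=> g0 /inf_lt[|c [k [U [V [MUV ->]]]] rg].
  by have [] := factorization_costs_has_inf M.
set r := row_norm U in rg; set s := col_norm V in rg.
have uv i j : dot (U i) (V^T j) = M i j.
  by rewrite MUV mxE; apply: eq_bigr => l _; rewrite mxE.
have ur i : dot (U i) (U i) <= r ^+ 2 by exact: dot_row_norm.
have vs j : dot (V^T j) (V^T j) <= s ^+ 2 by rewrite /s col_norm_tr; exact: dot_row_norm.
have norm0 (m' k' : nat) (W : 'M[R]_(m', k')) : 0 <= row_norm W.
  by rewrite /row_norm; elim/big_ind: _ => // [x y x0 y0|i _]; rewrite ?sqrtr_ge0 // le_max x0.
have r0 : 0 <= r by exact: norm0.
have s0 : 0 <= s by rewrite /s col_norm_tr; exact: norm0.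
have [rs|] := boolP ((0 < r) && (0 < s)); last first.
  rewrite negb_and -!leNgt => rs.
  (* If a norm vanishes, the matrix is 0 by Cauchy-Schwarz, and vectors in dimension 0 factor it. *)
  exists 0%N, (fun _ _ => 0), (fun _ _ => 0).
  have dot0 : dot (fun _ : 'I_0 => 0 : R) (fun=> 0) = 0 by rewrite /dot big_ord0.
  split=> [i|j|i j]; rewrite dot0 ?ltW // -uv.
  apply/eqP; rewrite eq_sym -sqrf_eq0 -(rwP eqP); apply: le_anti; rewrite sqr_ge0 andbT.
  apply: le_trans (dot_sqr_le _ _) _.
  case/orP: rs => h.
    have e : dot (U i) (U i) <= 0.
      by apply: le_trans (ur i) _; rewrite (_ : r = 0) ?expr0n //; lra.
    by rewrite mulr_le0_ge0 // dot_ge0.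
  have e : dot (V^T j) (V^T j) <= 0.
    by apply: le_trans (vs j) _; rewrite (_ : s = 0) ?expr0n //; lra.
  by rewrite mulr_ge0_le0 // dot_ge0.
have /andP[r_gt0 s_gt0] := rs.
pose x := Num.sqrt (s / r).
have x2 : x ^+ 2 = s / r by rewrite sqr_sqrtr // divr_ge0.
have x0 : x != 0 by rewrite sqrtr_eq0 -ltNge divr_gt0.
exists k, (fun i l => x * U i l), (fun j l => x^-1 * V^T j l); split=> [i|j|i j].
- rewrite dotZl dotC dotZl mulrA -expr2 x2; apply: le_trans (ltW rg).
  rewrite mulrAC ler_pdivrMr //; apply: le_trans (ler_wpM2l s0 (ur i)) _.
  by rewrite le_eqVlt; apply/orP; left; apply/eqP; ring.
- rewrite dotZl dotC dotZl mulrA -expr2 exprVn x2 invf_div; apply: le_trans (ltW rg).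
  rewrite mulrAC ler_pdivrMr //; apply: le_trans (ler_wpM2l r0 (vs j)) _.
  by rewrite le_eqVlt; apply/orP; left; apply/eqP; ring.
- by rewrite dotZl dotC dotZl mulrA divff // mul1r dotC uv.
Qed.

Lemma num_ones_sum (m n : nat) (M : 'M[bool]_(m, n)) :
  num_ones M = ones (fun i j => M i j) [set: 'I_m] [set: 'I_n].
Proof.
rewrite /num_ones /ones -sum1_card big_mkcond pair_big_dep [RHS]big_mkcond.
by apply: eq_bigr => -[i j] _; rewrite !inE /=; case: (M i j).
Qed.

From mathcomp Require Import all_classical all_reals all_analysis.

Theorem theorem5p2 (R : realType) :
  exists C : R, 0 < C /\
    forall (gamma : R) (n : nat) (M : 'M[bool]_n),
      0 < gamma ->
      gamma2 (real_mx R M) <= gamma ->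
      density R M <= 1 / 2 ->
      exists t : nat,
        n%:R * 2 `^ (- (C * gamma ^+ 3)) <= t%:R :> R /\ zero_submx M t t.
Proof.
(* The exponent is [64 * 128 * G ^ 3] with [G <= 4 gamma], which contributes another [4^3 = 64]. *)
exists (64 * 128 * 64); split; first by rewrite !mulr_gt0.
move=> gamma n M g0 gM dM.
(* A zero matrix is treated apart, since a one in [M] is what bounds [gamma] from below; this also
   covers [n = 0]. *)
have [M0|] := boolP [forall i, forall j, ~~ M i j].
  exists n; split.
    rewrite ler_piMr // -[leRHS](powRr0 2) ler_powR ?ler1n // oppr_le0.
    by apply: mulr_ge0; rewrite ?exprn_ge0 // ltW.
  exists [set: 'I_n], [set: 'I_n]; rewrite cardsT card_ord; split=> // i j _ _.
  by apply/negbTE; have /forallP/(_ i)/forallP/(_ j) := M0.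
rewrite negb_forall => /existsP[i0]; rewrite negb_forall => /existsP[j0].
rewrite negbK => Mij.
have n0 : (0 < n)%N by apply: leq_ltn_trans (ltn_ord i0).
(* The infimum is only approached, so [gamma] is relaxed to [2 * gamma] to have a strict
   inequality. *)
have [k [u [v [ug vg uv]]]] : exists (k : nat) (u v : 'I_n -> 'I_k -> R),
    [/\ forall i, dot (u i) (u i) <= 2 * gamma, forall j, dot (v j) (v j) <= 2 * gamma &
        forall i j, dot (u i) (v j) = real_mx R M i j].
  by apply: gamma2_vectors; [rewrite mulr_gt0|apply: le_lt_trans gM _; lra].
have uvM i j : dot (u i) (v j) = (M i j)%:R by rewrite uv mxE.
have g1 : 1 <= 2 * gamma.
  have := dot_sqr_le (u i0) (v j0); rewrite uvM Mij expr1n => h.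
  have : 1 <= (2 * gamma) ^+ 2.
    by apply: le_trans h _; rewrite expr2; apply: ler_pM; rewrite ?dot_ge0.
  by rewrite expr_ge1 // mulr_ge0 // ltW.
(* Rounding up at most doubles [2 * gamma], because [1 <= 2 * gamma]. *)
pose G := (Num.truncn (2 * gamma)).+1.
have /andP[Gl Gu] : (Num.truncn (2 * gamma))%:R <= 2 * gamma < G%:R.
  by apply: truncn_itv; lra.
have G4 : G%:R <= 4 * gamma by move: Gl; rewrite /G -natr1; lra.
have G43 : G%:R ^+ 3 <= (4 * gamma) ^+ 3 by rewrite lerXn2r // nnegrE; lra.
have [||||||A [B [_ _ cA cB zAB]]] :=
  @zero_rectangle R _ _ _ (fun i j => M i j) u v G _ _ _ _ _ uvM.
- by rewrite card_ord.
- by rewrite card_ord.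
- by [].
- by move=> i; apply: le_trans (ug i) (ltW Gu).
- by move=> j; apply: le_trans (vg j) (ltW Gu).
- move: dM; rewrite /density /area -num_ones_sum !cardsT !card_ord -natrM.
  by rewrite ler_pdivrMr // ltr0n muln_gt0 n0.
rewrite card_ord in cA cB.
set D := (64 * 128 * G ^ 3)%N in cA cB.
have small : n%:R * 2 `^ (- (64 * 128 * 64 * gamma ^+ 3)) <= n%:R / 2 ^+ D.
  rewrite ler_wpM2l // -(powR_mulrn D) // -powRN ler_powR ?ler1n // lerN2.
  have -> : 64 * 128 * 64 * gamma ^+ 3 = 64 * 128 * (4 * gamma) ^+ 3.
    by rewrite exprMn -mulrA (_ : 4 ^+ 3 = 64) //; ring.
  rewrite /D natrM natrX natrM; apply: ler_wpM2l G43; exact: mulr_ge0.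
(* The longer side is cut down to the shorter one to obtain a square. *)
exists (minn #|A| #|B|); split.
  by rewrite natr_min le_min !(le_trans small).
have [A' A'A cA'] := exists_subset_card (geq_minl #|A| #|B|).
have [B' B'B cB'] := exists_subset_card (geq_minr #|A| #|B|).
exists A', B'; split=> // i j iA jB.
by apply: zAB; [exact: (fintype.subsetP A'A)|exact: (fintype.subsetP B'B)].
Qed.
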